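(* Let $\mathcal L_0\subset\mathbb R^d$ be an $(r,R)$-Delone set and $N\ge1$. For $s\in\mathcal S_N$, the formula $$\tau_s(\xi):=\hat{\mathfrak t}_{\chi_\xi\circ s^{-1}(1)}\big(\Lambda_s(\xi),\xi\big),\qquad\xi\in\Xi^{(N)}_{\mathcal L_0},$$ defines a group homomorphism $\tau:\mathcal S_N\to\mathcal S(\mathcal G_N)$ into the group of bisections of $\mathcal G_N$, and thus a 2-action of $\mathcal S_N$ on $\mathcal G_N$.
   Context: Fix $d\ge1$, $0<r<R$. $\mathcal L\subset\mathbb R^d$ (discrete, infinite) is $(r,R)$-Delone if each closed ball of radius $r$ contains at most one point and each closed ball of radius $R$ at least one point of $\mathcal L$; $\mathrm{Del}$ is the set of these, with the topology of the metric $D(\Lambda,\Lambda')=\inf\{1/(1+\rho):d_H(\Lambda[\rho],\Lambda'[\rho])<1/\rho\}$ on closed subsets of $\mathbb R^d$, where $\Lambda[\rho]=(\Lambda\cap B(0,\rho))\cup\partial B(0,\rho)$ and $d_H$ is the Hausdorff distance. The hull $\Omega_{\mathcal L_0}$ is the closure of $\{\mathcal L_0-a:a\in\mathbb R^d\}$. $\widehat{\mathrm{Del}}^{(N)}$ is the set of triples $\xi=(\mathcal L_\xi,V_\xi,\chi_\xi)$ with $\mathcal L_\xi\in\mathrm{Del}$, $V_\xi\subset\mathcal L_\xi$, $|V_\xi|=N$, and $\chi_\xi:\{1,\dots,N\}\to V_\xi$ a bijection. A neighborhood base at $(\mathcal L,V,\chi)$ is given by the sets of all $(\mathcal L',V',g\circ\chi)$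 with $d_H(\mathcal L[M],\mathcal L'[M])<\epsilon$, $V'\subset\mathcal L'$, $|V'|=N$, $d_H(V,V')<\epsilon$, $g:V\to V'$ the unique bijection with $|g(v)-v|<\epsilon$, for $0<\epsilon<r/2$ and $M$ large. $\widehat{\mathrm{Del}}^{(N,N)}=\{(\xi,\zeta)\in\widehat{\mathrm{Del}}^{(N)}\times\widehat{\mathrm{Del}}^{(N)}:\mathcal L_\xi=\mathcal L_\zeta\}$ with the relative product topology. $\mathfrak t_x(y)=y-x$, $\hat{\mathfrak t}_x\xi=(\mathcal L_\xi-x,V_\xi-x,\mathfrak t_x\circ\chi_\xi)$, $\hat{\mathfrak t}_x(\xi,\zeta)=(\hat{\mathfrak t}_x\xi,\hat{\mathfrak t}_x\zeta)$. For $s$ in the symmetric group $\mathcal S_N$, $\Lambda_s(\xi)=(\mathcal L_\xi,V_\xi,\chi_\xi\circ s^{-1})$. $\mathcal G_N=\{(\xi,\zeta)\in\widehat{\mathrm{Del}}^{(N,N)}:\mathcal L_\xi=\mathcal L_\zeta\in\Omega_{\mathcal L_0},\ \chi_\xi(1)=0\}$ (relative topology) is an étale groupoid with $(\xi,\zeta)^{-1}=\hat{\mathfrak t}_{\chi_\zeta(1)}(\zeta,\xi)$, composition $(\xi,\zeta)\cdot\hat{\mathfrak t}_{\chi_\zeta(1)}(\zeta,\zeta')=(\xi,\zeta')$, range $\mathfrak r(\xi,\zeta)=(\xi,\xi)$ and source $\mathfrak s(\xi,\zeta)=\hat{\mathfrak t}_{\chi_\zeta(1)}(\zeta,\zeta)$;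 units $(\xi,\xi)$ are identified with $\xi\in\Xi^{(N)}_{\mathcal L_0}=\{\xi\in\widehat{\mathrm{Del}}^{(N)}:\mathcal L_\xi\in\Omega_{\mathcal L_0},\ \chi_\xi(1)=0\}$. For a topological groupoid $\mathcal G$, the group of bisections $\mathcal S(\mathcal G)$ is the set of continuous $b:\mathcal G^{(0)}\to\mathcal G$ with $\mathfrak s\circ b=\mathrm{Id}$ and $\mathfrak r\circ b$ a homeomorphism, with product $(b_1\cdot b_2)(x)=b_1(\mathfrak r\circ b_2(x))\,b_2(x)$ and inverse $b^{-1}(x)=b((\mathfrak r\circ b)^{-1}(x))^{-1}$. A 2-action of a discrete group $\Gamma$ on $\mathcal G$ is a group homomorphism $\Gamma\to\mathcal S(\mathcal G)$. *)

(* Defs.v *)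
From HB Require Import structures.
From mathcomp Require Import all_boot all_order all_algebra all_fingroup.
From mathcomp Require Import ring lra.
From mathcomp Require Import all_classical all_reals all_analysis.

Set Implicit Arguments.
Unset Strict Implicit.
Unset Printing Implicit Defensive.
Import Order.TTheory GRing.Theory Num.Theory.
Import numFieldNormedType.Exports.
Local Open Scope classical_set_scope.
Local Open Scope ring_scope.

Section Euclidean.
Context {R : realType} {d : nat}.
Implicit Types (x y a b : 'rV[R]_d) (A B C : set 'rV[R]_d).

(* The library's norm on 'rV[R]_d is the sup norm. *)
Definition enorm x : R := Num.sqrt (\sum_(i < d) x ord0 i ^+ 2).

Let sq x := \sum_(i < d) x ord0 i ^+ 2.
Let dot x y := \sum_(i < d) x ord0 i * y ord0 i.

Let sq_ge0 x : 0 <= sq x.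
Proof. by apply: sumr_ge0 => i _; exact: sqr_ge0. Qed.

Lemma enorm_ge0 x : 0 <= enorm x.
Proof. exact: sqrtr_ge0. Qed.

Lemma enorm_eq0 x : enorm x = 0 -> x = 0.
Proof.
move=> /eqP; rewrite sqrtr_eq0 => le0.
have /psumr_eq0P s0 : sq x = 0 by apply/eqP; rewrite eq_le le0 sq_ge0.
apply/rowP => i; rewrite mxE; apply/eqP; rewrite -sqrf_eq0.
by apply/eqP/s0 => // j _; exact: sqr_ge0.
Qed.

Lemma enormZ (k : R) x : enorm (k *: x) = `|k| * enorm x.
Proof.
rewrite /enorm -sqrtr_sqr -sqrtrM ?sqr_ge0//; congr Num.sqrt.
by rewrite mulr_sumr; apply: eq_bigr => i _; rewrite mxE exprMn.
Qed.

Lemma enorm0 : enorm 0 = 0.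
Proof. by rewrite -(scale0r (0 : 'rV[R]_d)) enormZ normr0 mul0r. Qed.

Lemma enormN x : enorm (- x) = enorm x.
Proof. by rewrite -scaleN1r enormZ normrN1 mul1r. Qed.

Lemma enormB x y : enorm (x - y) = enorm (y - x).
Proof. by rewrite -enormN opprB. Qed.

Let cauchy_schwarz x y : dot x y ^+ 2 <= sq x * sq y.
Proof.
have [y0|y0] := eqVneq (sq y) 0.
  have yi i : y ord0 i = 0.
    apply/eqP; rewrite -sqrf_eq0; apply/eqP.
    by move/psumr_eq0P : y0; apply => // j _; exact: sqr_ge0.
  by rewrite y0 mulr0 /dot big1 ?expr0n// => i _; rewrite yi mulr0.
have ypos : 0 < sq y by rewrite lt_def y0 sq_ge0.
have : 0 <= \sum_(i < d) (sq y * x ord0 i - dot x y * y ord0 i) ^+ 2.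
  by apply: sumr_ge0 => i _; exact: sqr_ge0.
suff -> : \sum_(i < d) (sq y * x ord0 i - dot x y * y ord0 i) ^+ 2 =
    sq y * (sq x * sq y - dot x y ^+ 2) by rewrite pmulr_rge0// subr_ge0.
rewrite (eq_bigr (fun i => sq y ^+ 2 * x ord0 i ^+ 2 +
  ((- 2 * sq y * dot x y) * (x ord0 i * y ord0 i) +
    dot x y ^+ 2 * y ord0 i ^+ 2))); last by move=> i _; ring.
rewrite !big_split/= -!mulr_sumr -/(sq x) -/(sq y) -/(dot x y); ring.
Qed.

Lemma ler_enormD x y : enorm (x + y) <= enorm x + enorm y.
Proof.
have e2 z : enorm z ^+ 2 = sq z by rewrite sqr_sqrtr// sq_ge0.
rewrite -(@ler_pXn2r _ 2)// ?nnegrE ?addr_ge0 ?enorm_ge0//.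
have le : dot x y <= enorm x * enorm y.
  rewrite (le_trans (ler_norm _))// -(@ler_pXn2r _ 2)//
    ?nnegrE ?mulr_ge0 ?enorm_ge0//.
  by rewrite real_normK ?num_real// exprMn !e2.
have -> : enorm (x + y) ^+ 2 = sq x + 2 * dot x y + sq y.
  rewrite e2 /sq /dot mulr_sumr -!big_split/=.
  by apply: eq_bigr => i _; rewrite mxE; ring.
rewrite sqrrD !e2 lerD2r lerD2l -mulr_natl; lra.
Qed.

Lemma ler_edist z x y : enorm (x - y) <= enorm (x - z) + enorm (z - y).
Proof. by rewrite (le_trans _ (ler_enormD _ _))// addrA subrK. Qed.

Lemma ler_edistD x y : enorm x <= enorm (x - y) + enorm y.
Proof. by rewrite (le_trans _ (ler_enormD _ _))// subrK. Qed.

Definition translate x A : set 'rV[R]_d := [set y - x | y in A].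

Lemma translate0 A : translate 0 A = A.
Proof.
by apply/seteqP; split=> [_ [y Ay <-]|y Ay]; [rewrite subr0|exists y; rewrite ?subr0].
Qed.

Lemma translateD x y A : translate y (translate x A) = translate (x + y) A.
Proof.
apply/seteqP; split=> [_ [_ [z Az <-] <-]|_ [z Az <-]].
  by exists z; rewrite // opprD addrA.
by exists (z - x); [exists z|rewrite opprD addrA].
Qed.

(* [trunc M A] is A[M]: A inside the ball of radius M, with the sphere added. *)
Definition trunc (M : R) A : set 'rV[R]_d :=
  (A `&` [set y | enorm y <= M]) `|` [set y | enorm y = M].

Local Open Scope ereal_scope.

(* Hausdorff distance *)
Definition dH A B : \bar R :=
  maxe (ereal_sup [set ereal_inf [set (enorm (a - b))%:E | b in B] | a in A])
       (ereal_sup [set ereal_inf [set (enorm (a - b))%:E | a in A] | b in B]).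

(* The infimum is taken in the extended reals, where inf of the empty set is
   +oo rather than 0. *)
Definition Ddist A B : \bar R :=
  ereal_inf [set ((1 + rho)^-1)%:E | rho in
    [set rho : R | (0 < rho)%R /\ dH (trunc rho A) (trunc rho B) < (rho^-1)%:E]].

Local Close Scope ereal_scope.

Definition within_dist (c : R) A B :=
  forall a, A a -> exists2 b, B b & enorm (a - b) < c.

Lemma dH_ltP A B (e : R) : 0 < e ->
  (dH A B < e%:E)%E <->
  exists c, [/\ 0 < c, c < e, within_dist c A B & within_dist c B A].
Proof.
move=> e0; split => [|[c [c0 ce AB BA]]]; last first.
  rewrite (@le_lt_trans _ _ c%:E) ?lte_fin// ge_max; apply/andP; split;
    apply: ge_ereal_sup => _ [a Aa <-].
    have [b Bb ab] := AB _ Aa.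
    rewrite (@le_trans _ _ (enorm (a - b))%:E) ?lee_fin//; last exact: ltW.
    by apply: ereal_inf_lbound; exists b.
  have [b Bb ab] := BA _ Aa.
  rewrite (@le_trans _ _ (enorm (b - a))%:E) ?lee_fin//; last first.
    by rewrite enormB; exact: ltW.
  by apply: ereal_inf_lbound; exists b.
rewrite /dH gt_max => /andP[].
have key (S : set \bar R) : (ereal_sup S < e%:E)%E ->
    exists c, [/\ 0 < c, c < e & forall t, S t -> (t < c%:E)%E].
  move=> Se; case sE : (ereal_sup S) Se => [s| |]//.
    rewrite lte_fin => se; exists ((Num.max s 0 + e) / 2).
    have ? : Num.max s 0 < e by rewrite gt_max se.
    have ? : 0 <= Num.max s 0 by rewrite le_max lexx orbT.
    have ? : s <= Num.max s 0 by rewrite le_max lexx.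
    split; [lra|lra|move=> t St].
    rewrite (@le_lt_trans _ _ s%:E) ?lte_fin; [|by rewrite -sE; exact: ereal_sup_ubound|lra].
    by [].
  move=> _; exists (e / 2); split; [lra|lra|move=> t St].
  by rewrite (@le_lt_trans _ _ -oo%E) ?ltNyr// -sE; exact: ereal_sup_ubound.
move=> /key[c1 [c10 c1e AB]] /key[c2 [c20 c2e BA]].
exists (Num.max c1 c2); split; rewrite ?lt_max ?c10 ?gt_max ?c1e//.
- move=> a Aa; have /ereal_inf_lt[_ [b Bb <-]] := AB _ (imageP _ Aa).
  by rewrite lte_fin => ab; exists b; rewrite ?lt_max ?ab.
- move=> b Bb; have /ereal_inf_lt[_ [a Aa <-]] := BA _ (imageP _ Bb).
  by rewrite lte_fin => ab; exists a; rewrite // enormB lt_max ab orbT.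
Qed.

Lemma dH_refl A (e : R) : 0 < e -> (dH A A < e%:E)%E.
Proof.
move=> e0; apply/dH_ltP => //; exists (e / 2).
by split; [lra|lra|move=> a Aa; exists a; rewrite ?subrr ?enorm0//; lra..].
Qed.

Lemma dH_sym A B : dH A B = dH B A.
Proof.
rewrite /dH maxC; congr (maxe (ereal_sup _) (ereal_sup _));
  by apply: eq_imagel => a _; congr ereal_inf; apply: eq_imagel => b _;
    rewrite enormB.
Qed.

Lemma within_dist_trans (c c' : R) B A C :
  within_dist c A B -> within_dist c' B C -> within_dist (c + c') A C.
Proof.
move=> AB BC a /AB[b /BC[c1 Cc1 bc] ab]; exists c1 => //.
by rewrite (le_lt_trans (ler_edist b _ _))// ltrD.
Qed.

Lemma dH_lt_trans B A C (e e' : R) : 0 < e -> 0 < e' ->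
  (dH A B < e%:E)%E -> (dH B C < e'%:E)%E -> (dH A C < (e + e')%:E)%E.
Proof.
move=> e0 e'0 /(dH_ltP _ _ e0)[c [c0 ce AB BA]].
move=> /(dH_ltP _ _ e'0)[c' [c'0 c'e BC CB]].
apply/dH_ltP; first exact: addr_gt0.
exists (c + c'); split; [exact: addr_gt0|exact: ltrD| |].
- exact: within_dist_trans AB BC.
- by rewrite addrC; exact: within_dist_trans CB BA.
Qed.

Lemma sphere_crossing a b (M : R) : enorm a <= M -> M < enorm b ->
  exists2 z, enorm z = M & enorm (a - z) <= enorm (a - b).
Proof.
move=> aM Mb; have M0 : 0 <= M := le_trans (enorm_ge0 a) aM.
have [/enorm_eq0 a0|a0] := eqVneq (enorm a) 0.
  exists ((M / enorm b) *: b).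
    rewrite enormZ ger0_norm ?divr_ge0 ?enorm_ge0// divfK// gt_eqF//.
    exact: le_lt_trans Mb.
  rewrite a0 !sub0r !enormN enormZ ger0_norm ?divr_ge0 ?enorm_ge0// divfK ?ltW//.
  by rewrite gt_eqF//; exact: le_lt_trans Mb.
have a1 : 0 < enorm a by rewrite lt_def a0 enorm_ge0.
exists ((M / enorm a) *: a).
  by rewrite enormZ ger0_norm ?divr_ge0 ?enorm_ge0// divfK.
have -> : a - (M / enorm a) *: a = (1 - M / enorm a) *: a.
  by rewrite scalerBl scale1r.
rewrite enormZ ler0_norm; last by rewrite subr_le0 ler_pdivlMr ?mul1r.
rewrite opprB mulrBl mul1r divfK//.
have := ler_edistD b a; rewrite enormB; lra.
Qed.

Lemma within_dist_translate A B x x' (c e M M' : R) :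
  0 < c -> enorm (x - x') <= e -> M + enorm x + c <= M' ->
  within_dist c (trunc M' A) (trunc M' B) ->
  within_dist (c + e) (trunc M (translate x A)) (trunc M (translate x' B)).
Proof.
move=> c0 xx' MM' AB a [[[p Ap <-] /= pM]|/= aM]; last first.
  exists a; first by right.
  by rewrite subrr enorm0 ltr_wpDr// (le_trans (enorm_ge0 _) xx').
have pM' : enorm p <= M + enorm x.
  by rewrite (le_trans (ler_edistD p x))// lerD2r.
have [|q [[Bq qM']|/= qM'] pq] := AB p.
- by left; split => //=; rewrite (le_trans pM')// (le_trans _ MM')// lerDl ltW.
- have ab : enorm (p - x - (q - x')) < c + e.
    have -> : p - x - (q - x') = (p - q) + (x' - x).
      by rewrite opprB addrACA [RHS]addrACA; congr (_ + _); rewrite addrC.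
    by rewrite (le_lt_trans (ler_enormD _ _))// ltr_leD// enormB.
  have [bM|bM] := leP (enorm (q - x')) M.
    by exists (q - x') => //; left; split => //; exists q.
  have [z zM az] := sphere_crossing pM bM.
  by exists z; [right|exact: le_lt_trans az ab].
- have := ler_edistD q p; rewrite enormB qM' => qp.
  exfalso; move: pq qp pM' MM'; lra.
Qed.

Lemma dH_translate A B x x' (e e' M M' : R) :
  0 < e -> enorm (x - x') <= e' -> M + enorm x + e + e' <= M' ->
  (dH (trunc M' A) (trunc M' B) < e%:E)%E ->
  (dH (trunc M (translate x A)) (trunc M (translate x' B)) < (e + e')%:E)%E.
Proof.
move=> e0 xx' MM' /(dH_ltP _ _ e0)[c [c0 ce AB BA]].
have e'0 : 0 <= e' := le_trans (enorm_ge0 _) xx'.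
have := ler_edistD x' x; rewrite enormB => xlt.
apply/dH_ltP; first by rewrite ltr_wpDr.
exists (c + e'); split; first by rewrite ltr_wpDr.
- by rewrite ltrD2r.
- by apply: within_dist_translate AB => //; lra.
- by apply: within_dist_translate BA => //; rewrite 1?enormB//; lra.
Qed.

Lemma dH_trunc_le A B (e M M' : R) : 0 < e -> M + e <= M' ->
  (dH (trunc M' A) (trunc M' B) < e%:E)%E ->
  (dH (trunc M A) (trunc M B) < e%:E)%E.
Proof.
move=> e0 MM' AB; rewrite -(translate0 A) -(translate0 B) -[e]addr0.
by apply: dH_translate AB => //; rewrite ?subrr ?enorm0 ?addr0.
Qed.

End Euclidean.

Definition is_delone (R : realType) (d : nat) (r Rc : R) (L : set 'rV[R]_d) :=
  [/\ 0 < r < Rc,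
      infinite_set L,
      (forall x, L x ->
         exists2 e, 0 < e & forall y, L y -> enorm (y - x) < e -> y = x),
      (forall c x y, L x -> L y -> enorm (x - c) <= r -> enorm (y - c) <= r ->
         x = y) &
      (forall c, exists2 x, L x & enorm (x - c) <= Rc)].

Record Del (R : realType) (d : nat) (r Rc : R) := MkDel {
  dset :> set 'rV[R]_d;
  delP : is_delone r Rc dset }.

(* Labels {1, ..., N} are represented by 'I_n.+1 with N = n.+1, the label 1
   being ord0. *)
Record hatDel (R : realType) (d : nat) (r Rc : R) (n : nat) := MkHatDel {
  lat : Del d r Rc;
  vert : set 'rV[R]_d;
  lab : 'I_n.+1 -> 'rV[R]_d;
  vert_sub : vert `<=` lat;
  lab_bij : set_bij [set: 'I_n.+1] vert lab }.

Section HatDel.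
Context {R : realType} {d : nat} {r Rc : R}.
Local Notation E := 'rV[R]_d.

Lemma Del_eq (L L' : Del d r Rc) : dset L = dset L' -> L = L'.
Proof.
case: L L' => [A pA] [B pB] /= AB; case: _ / AB pB => pB.
by congr MkDel; exact: Prop_irrelevance.
Qed.

Lemma delone_translate x (L : set E) :
  is_delone r Rc L -> is_delone r Rc (translate x L).
Proof.
case=> r0 infL disc pack cov; split => //.
- move=> fin; apply: infL.
  have -> : L = translate (- x) (translate x L).
    by rewrite translateD subrr translate0.
  exact: finite_image.
- move=> _ [y Ly <-]; have [e e0 ye] := disc _ Ly.
  exists e => // _ [z Lz <-]; rewrite opprB addrA subrK => zy.
  by rewrite (ye z).
- move=> c _ _ [y Ly <-] [z Lz <-]; rewrite -!addrA -!opprD => yc zc.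
  by rewrite (pack (x + c) y z).
- move=> c; have [y Ly yc] := cov (x + c).
  by exists (y - x); [exists y|rewrite -addrA -opprD].
Qed.

Definition del_translate x (L : Del d r Rc) : Del d r Rc :=
  MkDel (delone_translate x (delP L)).

(* closure of the orbit of L0 under translations, for the metric Ddist *)
Definition hull (L0 : Del d r Rc) : set (Del d r Rc) :=
  [set L | forall e : R, 0 < e ->
    exists a : E, (Ddist L (del_translate a L0) < e%:E)%E].

Lemma hull_translate x (L0 L : Del d r Rc) :
  hull L0 L -> hull L0 (del_translate x L).
Proof.
move=> hL e e0.
have ei0 : 0 < e^-1 by rewrite invr_gt0.
have xge := enorm_ge0 x.
have s0 : 0 < e^-1 + enorm x + 2 by lra.
have si0 : 0 < (e^-1 + enorm x + 2)^-1 by rewrite invr_gt0.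
have [a /ereal_inf_lt[_ [rho [rho0 Hd] <-]]] := hL _ si0.
rewrite lte_fin ltf_pV2 ?posrE// => [rlt|]; last by lra.
exists (a + x); rewrite (@le_lt_trans _ _ ((1 + e^-1)^-1)%:E)//; last first.
  by rewrite lte_fin -[ltRHS]invrK ltf_pV2 ?posrE//; lra.
apply: ereal_inf_lbound; exists e^-1 => //; split => //=.
have ri0 : 0 < rho^-1 by rewrite invr_gt0.
have ri1 : rho^-1 < 1 by rewrite invf_lt1//; lra.
have rie : rho^-1 < e by rewrite -[ltRHS]invrK ltf_pV2 ?posrE//; lra.
rewrite invrK -translateD (@lt_trans _ _ (rho^-1)%:E) ?lte_fin//.
rewrite -[rho^-1]addr0; apply: dH_translate Hd => //.
  by rewrite subrr enorm0.
by lra.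
Qed.

Section Labelled.
Context {n : nat}.
Local Notation hatDel := (hatDel d r Rc n).
Implicit Types xi zeta : hatDel.

Lemma vertE xi : vert xi = range (lab xi).
Proof.
have [fL _ sL] := lab_bij xi; apply/seteqP; split=> [v /sL//|_ [i _ <-]].
exact: fL.
Qed.

Lemma lab_inj xi : injective (lab xi).
Proof.
by have [_ iL _] := lab_bij xi => i j; apply: iL; exact: mem_setT.
Qed.

Lemma hatDel_eq xi zeta :
  dset (lat xi) = dset (lat zeta) -> lab xi =1 lab zeta -> xi = zeta.
Proof.
move=> /Del_eq EL /funext El; have := vertE zeta; have := vertE xi.
case: xi zeta EL El => [L V l p q] [L' V' l' p' q'] /= EL El.
case: _ / EL p' => p'; case: _ / El q' => q' EV EV'.
have EVV : V = V' by rewrite EV EV'.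
case: _ / EVV p' q' {EV EV'} => p' q'.
by congr MkHatDel; exact: Prop_irrelevance.
Qed.

(* Since e < r / 2, there is at most one such g. *)
Definition basic_nbhs xi (e M : R) : set hatDel :=
  [set xi' | [/\ (dH (trunc M (lat xi)) (trunc M (lat xi')) < e%:E)%E,
                 (dH (vert xi) (vert xi') < e%:E)%E &
                 exists g : E -> E,
                   [/\ set_bij (vert xi) (vert xi') g,
                       forall v, vert xi v -> enorm (g v - v) < e &
                       lab xi' = g \o lab xi]]].

Definition hatDel_nbhs xi : set_system hatDel :=
  [set A | exists2 e, 0 < e < r / 2 &
                      \forall M \near +oo, basic_nbhs xi e M `<=` A].

Lemma basic_nbhsP xi xi' (e M : R) : 0 < e ->
  basic_nbhs xi e M xi' <->
  (dH (trunc M (lat xi)) (trunc M (lat xi')) < e%:E)%E /\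
  forall i, enorm (lab xi' i - lab xi i) < e.
Proof.
move=> e0; split => [[dL _ [g [_ gv lg]]]|[dL dl]].
  split => // i; rewrite lg; apply: gv; rewrite vertE; exact: imageT.
split => //.
  apply/dH_ltP => //.
  pose c := \big[Num.max/e / 2]_i enorm (lab xi' i - lab xi i).
  exists ((c + e) / 2).
  have ce : c < e.
    by apply: bigmax_lt => [|i _]; [lra|exact: dl].
  have c0 : e / 2 <= c by exact: bigmax_ge_id.
  have ci i : enorm (lab xi' i - lab xi i) < (c + e) / 2.
    by rewrite (@le_lt_trans _ _ c)//; [exact: le_bigmax|lra].
  rewrite !vertE; split; [lra|lra| |] => _ [i _ <-].
  - by exists (lab xi' i); [exact: imageT|rewrite enormB].
  - by exists (lab xi i); [exact: imageT|].
pose g v := if pselect (exists i, lab xi i = v) is left H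
            then lab xi' (projT1 (cid H)) else v.
have gE i : g (lab xi i) = lab xi' i.
  rewrite /g; case: pselect => [H|[]]; last by exists i.
  by case: (cid H) => j /= /lab_inj ->.
exists g; split.
- rewrite !vertE; split.
  + by move=> _ [i _ <-]; rewrite gE; exact: imageT.
  + move=> _ _ /set_mem[i _ <-] /set_mem[j _ <-].
    by rewrite !gE => /lab_inj ->.
  + by move=> _ [i _ <-]; exists (lab xi i); rewrite ?gE//; exact: imageT.
- by rewrite vertE => _ [i _ <-]; rewrite gE.
- by apply/funext => i /=; rewrite gE.
Qed.

Lemma hatDel_r_gt0 xi : 0 < r.
Proof. by have [/andP[]] := delP (lat xi). Qed.

Lemma basic_nbhs_le xi (e e' M M' : R) : 0 < e -> e <= e' -> M + e <= M' ->
  basic_nbhs xi e M' `<=` basic_nbhs xi e' M.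
Proof.
move=> e0 ee' MM' zeta /(basic_nbhsP _ _ _ e0)[dL dl].
apply/basic_nbhsP; first exact: lt_le_trans ee'.
split=> [|i]; last exact: lt_le_trans ee'.
rewrite (@lt_le_trans _ _ e%:E) ?lee_fin//.
exact: dH_trunc_le MM' dL.
Qed.

Lemma basic_nbhs_trans xi xi' xi'' (e e' M : R) : 0 < e -> 0 < e' ->
  basic_nbhs xi e M xi' -> basic_nbhs xi' e' M xi'' ->
  basic_nbhs xi (e + e') M xi''.
Proof.
move=> e0 e'0 /(basic_nbhsP _ _ _ e0)[dL dl] /(basic_nbhsP _ _ _ e'0)[dL' dl'].
apply/basic_nbhsP; first exact: addr_gt0.
split=> [|i]; first exact: dH_lt_trans dL dL'.
rewrite (le_lt_trans (ler_edist (lab xi' i) _ _))// addrC.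
by rewrite ltrD.
Qed.

(* A neighbourhood only has to contain one basic set; the radius may be
   enlarged since basic sets decrease as M grows. *)
Lemma hatDel_nbhsP xi (A : set hatDel) : hatDel_nbhs xi A <->
  exists e M, 0 < e /\ basic_nbhs xi e M `<=` A.
Proof.
split=> [[e /andP[e0 _] [M [_ HM]]]|[e [M [e0 HA]]]].
  by exists e, (M + 1); split => //; apply: HM; rewrite ltrDl.
have r0 := hatDel_r_gt0 xi.
pose e' := Num.min e (r / 4).
have e'0 : 0 < e' by rewrite lt_min e0; lra.
have e'e : e' <= e by rewrite ge_min lexx.
have e'r : e' <= r / 4 by rewrite ge_min lexx orbT.
exists e'; first by lra.
exists (M + e'); split; first exact: num_real.
by move=> M' /ltW MM'; apply: subset_trans HA; exact: basic_nbhs_le.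
Qed.

Lemma basic_nbhs_refl xi (e M : R) : 0 < e -> basic_nbhs xi e M xi.
Proof.
move=> e0; apply/basic_nbhsP => //; split => [|i]; first exact: dH_refl.
by rewrite subrr enorm0.
Qed.

End Labelled.
End HatDel.

HB.instance Definition _ (R : realType) (d : nat) (r Rc : R) (n : nat) :=
  gen_eqMixin (hatDel d r Rc n).
HB.instance Definition _ (R : realType) (d : nat) (r Rc : R) (n : nat) :=
  gen_choiceMixin (hatDel d r Rc n).
HB.instance Definition _ (R : realType) (d : nat) (r Rc : R) (n : nat) :=
  hasNbhs.Build (hatDel d r Rc n) hatDel_nbhs.

Section HatDelTopology.
Context {R : realType} {d : nat} {r Rc : R} {n : nat}.
Local Notation hatDel := (hatDel d r Rc n).
Implicit Types (xi : hatDel) (A : set hatDel).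

Let nbhs_filter xi : ProperFilter (nbhs xi).
Proof.
apply: Build_ProperFilter_ex => [A /hatDel_nbhsP[e [M [e0 HA]]]|].
  by exists xi; apply: HA; exact: basic_nbhs_refl.
split.
- by apply/hatDel_nbhsP; exists 1, 0; split.
- move=> A B /hatDel_nbhsP[e [M [e0 HA]]] /hatDel_nbhsP[e' [M' [e'0 HB]]].
  apply/hatDel_nbhsP; pose e1 := Num.min e e'.
  have e10 : 0 < e1 by rewrite lt_min e0.
  exists e1, (Num.max M M' + e1); split => // zeta zxi; split.
  + apply: HA; apply: basic_nbhs_le zxi => //.
    * by rewrite ge_min lexx.
    * by rewrite lerD2r le_max lexx.
  + apply: HB; apply: basic_nbhs_le zxi => //.
    * by rewrite ge_min lexx orbT.
    * by rewrite lerD2r le_max lexx orbT.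
- move=> A B AB /hatDel_nbhsP[e [M [e0 HA]]]; apply/hatDel_nbhsP.
  by exists e, M; split => // t /HA/AB.
Qed.

Let nbhs_singleton xi A : nbhs xi A -> A xi.
Proof.
by move=> /hatDel_nbhsP[e [M [e0 HA]]]; apply: HA; exact: basic_nbhs_refl.
Qed.

Let nbhs_nbhs xi A : nbhs xi A -> nbhs xi (nbhs^~ A).
Proof.
move=> /hatDel_nbhsP[e [M [e0 HA]]]; apply/hatDel_nbhsP.
exists (e / 2), M; split; first by lra.
move=> zeta xz; apply/hatDel_nbhsP; exists (e / 2), (M + e / 2).
split; first by lra.
move=> eta zeta_eta; apply: HA; rewrite (splitr e).
have e20 : 0 < e / 2 by lra.
apply: (basic_nbhs_trans e20 e20 xz).
exact: basic_nbhs_le zeta_eta.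
Qed.

HB.instance Definition _ :=
  Nbhs_isNbhsTopological.Build hatDel nbhs_filter nbhs_singleton nbhs_nbhs.

Lemma cvg_hatDelP (T : Type) (F : set_system T) {FF : Filter F}
    (f : T -> hatDel) xi :
  f @ F --> xi <->
  forall e M, 0 < e -> \forall t \near F, basic_nbhs xi e M (f t).
Proof.
split=> [Fxi e M e0|H A].
  apply: (Fxi (basic_nbhs xi e M)); apply/hatDel_nbhsP.
  by exists e, M; split.
move=> /hatDel_nbhsP[e [M [e0 HA]]].
apply: (@filterS _ F _ (fun t => basic_nbhs xi e M (f t))); last exact: H.
by move=> t /HA.
Qed.

Lemma cvg_lab (T : Type) (F : set_system T) {FF : Filter F}
    (f : T -> hatDel) xi i :
  f @ F --> xi ->
  forall e, 0 < e -> \forall t \near F, enorm (lab (f t) i - lab xi i) < e.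
Proof.
move=> /cvg_hatDelP Fxi e e0; apply: filterS (Fxi e 0 e0) => t.
by move=> /(basic_nbhsP _ _ _ e0)[_].
Qed.

End HatDelTopology.

Section Translation.
Context {R : realType} {d : nat} {r Rc : R} {n : nat}.
Local Notation E := 'rV[R]_d.
Local Notation hatDel := (hatDel d r Rc n).
Implicit Types (xi zeta : hatDel) (p : hatDel * hatDel) (x y : E).

Lemma translate_sub x xi :
  translate x (vert xi) `<=` del_translate x (lat xi).
Proof. by move=> _ [y Vy <-]; exists y => //; exact: vert_sub. Qed.

Lemma translate_lab_bij x xi :
  set_bij [set: 'I_n.+1] (translate x (vert xi)) ((fun y => y - x) \o lab xi).
Proof.
rewrite vertE; split.
- by move=> i _; exists (lab xi i) => //; exact: imageT.
- by move=> i j _ _ /addIr/lab_inj.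
- by move=> _ [_ [i _ <-] <-]; exists i.
Qed.

Definition ttr x xi : hatDel :=
  MkHatDel (translate_sub (x := x) (xi := xi)) (translate_lab_bij x xi).

Definition ttr2 x p : hatDel * hatDel := (ttr x p.1, ttr x p.2).

Lemma labs_bij (s : 'S_n.+1) xi :
  set_bij [set: 'I_n.+1] (vert xi) (lab xi \o (s^-1)%g).
Proof.
rewrite vertE; split.
- by move=> i _; exact: imageT.
- by move=> i j _ _ /lab_inj/perm_inj.
- by move=> _ [i _ <-]; exists (s i) => //=; rewrite permK.
Qed.

Definition Lambda (s : 'S_n.+1) xi : hatDel :=
  MkHatDel (vert_sub (h := xi)) (labs_bij s xi).

Lemma ttr0 xi : ttr 0 xi = xi.
Proof.
by apply: hatDel_eq => [|i] /=; rewrite ?translate0 ?subr0.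
Qed.

Lemma ttrD x y xi : ttr y (ttr x xi) = ttr (x + y) xi.
Proof.
by apply: hatDel_eq => [|i] /=; rewrite ?translateD ?opprD ?addrA.
Qed.

Lemma cvg_ttr (T : Type) (F : set_system T) {FF : Filter F}
    (f : T -> hatDel) (u : T -> E) xi x :
  f @ F --> xi ->
  (forall e, 0 < e -> \forall t \near F, enorm (u t - x) < e) ->
  (fun t => ttr (u t) (f t)) @ F --> ttr x xi.
Proof.
move=> /cvg_hatDelP Fxi Fu; apply/cvg_hatDelP => e M e0.
have e20 : 0 < e / 2 by lra.
apply: filterS2 (Fxi (e / 2) (M + enorm x + e) e20) (Fu _ e20) => t.
move=> /(basic_nbhsP _ _ _ e20)[dL dl] ux; apply/basic_nbhsP => //; split.
  rewrite (splitr e) /=; apply: dH_translate dL => //.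
  - by rewrite enormB ltW.
  - lra.
move=> i /=; have -> : lab (f t) i - u t - (lab xi i - x) =
    (lab (f t) i - lab xi i) + (x - u t).
  by rewrite opprB addrACA [RHS]addrACA; congr (_ + _); rewrite addrC.
rewrite (le_lt_trans (ler_enormD _ _))// (splitr e) ltrD// enormB//.
Qed.

End Translation.

Definition homeomorphism (X Y : topologicalType) (f : X -> Y) :=
  continuous f /\ exists g, [/\ continuous g, cancel f g & cancel g f].

(* The product [gmul g h] is meaningful only when [gsrc g = grng h]; its values
   elsewhere are irrelevant. *)
Record topGroupoid := TopGroupoid {
  gunits : topologicalType;
  garrows : topologicalType;
  gsrc : garrows -> gunits;
  grng : garrows -> gunits;
  gunit : gunits -> garrows;
  ginv : garrows -> garrows;
  gmul : garrows -> garrows -> garrows;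
  gsrc_unit : forall x, gsrc (gunit x) = x;
  grng_unit : forall x, grng (gunit x) = x;
  gsrc_inv : forall g, gsrc (ginv g) = grng g;
  grng_inv : forall g, grng (ginv g) = gsrc g;
  gsrc_mul : forall g h, gsrc g = grng h -> gsrc (gmul g h) = gsrc h;
  grng_mul : forall g h, gsrc g = grng h -> grng (gmul g h) = grng g;
  gmulA : forall g h k, gsrc g = grng h -> gsrc h = grng k ->
    gmul g (gmul h k) = gmul (gmul g h) k;
  gmul1g : forall g, gmul (gunit (grng g)) g = g;
  gmulg1 : forall g, gmul g (gunit (gsrc g)) = g;
  gmulVg : forall g, gmul (ginv g) g = gunit (gsrc g);
  gmulgV : forall g, gmul g (ginv g) = gunit (grng g);
  gsrc_continuous : continuous gsrc;
  grng_continuous : continuous grng;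
  gunit_continuous : continuous gunit;
  ginv_continuous : continuous ginv;
  gmul_continuous :
    {within [set p : garrows * garrows | gsrc p.1 = grng p.2],
      continuous (fun p => gmul p.1 p.2)} }.

Record bisection (G : topGroupoid) := Bisection {
  bfun :> gunits G -> garrows G;
  bfun_continuous : continuous bfun;
  bfun_src : forall x, gsrc (bfun x) = x;
  bfun_rng : homeomorphism (fun x => grng (bfun x)) }.

Arguments gsrc_continuous {G} : rename.
Arguments grng_continuous {G} : rename.
Arguments gunit_continuous {G} : rename.
Arguments ginv_continuous {G} : rename.
Arguments bfun_continuous {G} b : rename.

Section BisectionGroup.
Context {G : topGroupoid}.
Implicit Types b : bisection G.

Lemma bisection_eq b b' : b =1 b' -> b = b'.
Proof.
case: b b' => [f c s r] [f' c' s' r'] /= /funext E.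
case: _ / E c' s' r' => c' s' r'.
by congr Bisection; exact: Prop_irrelevance.
Qed.

Lemma cvg_gmul (T : Type) (F : set_system T) {FF : Filter F}
    (f h : T -> garrows G) g k :
  (forall t, gsrc (f t) = grng (h t)) -> gsrc g = grng k ->
  f @ F --> g -> h @ F --> k -> (fun t => gmul (f t) (h t)) @ F --> gmul g k.
Proof.
move=> fh gk Fg Fk A /=.
have /subspace_continuousP/(_ (g, k) gk) := @gmul_continuous G.
move=> /(_ A)/[apply]; rewrite nbhs_simpl/= /within/= => HA.
have : (fun t => (f t, h t)) @ F --> (g, k) by exact: cvg_pair.
move=> /(_ _ HA) H; apply: (@filterS _ F _ _ _ _ H) => t /=.
by apply; exact: fh.
Qed.

Lemma bmul_rngE b1 b2 x :
  grng (gmul (b1 (grng (b2 x))) (b2 x)) = grng (b1 (grng (b2 x))).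
Proof. by rewrite grng_mul// bfun_src. Qed.

Definition bmul b1 b2 : bisection G.
Proof.
refine (@Bisection G (fun x => gmul (b1 (grng (b2 x))) (b2 x)) _ _ _).
- move=> x; have b2c := bfun_continuous b2 x.
  apply: cvg_gmul => [t| | |//]; rewrite ?bfun_src//.
  apply: (@cvg_comp _ _ _ (fun x => grng (b2 x)) b1 (nbhs x)
    (nbhs (grng (b2 x)))); last exact: bfun_continuous.
  by have [+ _] := bfun_rng b2; apply.
- by move=> x; rewrite gsrc_mul !bfun_src.
- have [c1 [h1 [ch1 k1 k1']]] := bfun_rng b1.
  have [c2 [h2 [ch2 k2 k2']]] := bfun_rng b2.
  have -> : (fun x => grng (gmul (b1 (grng (b2 x))) (b2 x))) =
            (fun x => grng (b1 (grng (b2 x)))).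
    by apply/funext => x; rewrite bmul_rngE.
  split=> [x|].
    exact: (@continuous_comp _ _ _ (fun x => grng (b2 x))
             (fun x => grng (b1 x)) x (c2 x) (c1 _)).
  exists (h2 \o h1); split => [x|x|x] /=.
  + exact: (@continuous_comp _ _ _ h1 h2 x (ch1 x) (ch2 _)).
  + by rewrite k1 k2.
  + by rewrite k2' k1'.
Defined.

Definition bone : bisection G.
Proof.
refine (@Bisection G (@gunit G) gunit_continuous (@gsrc_unit G) _).
have -> : (fun x => grng (@gunit G x)) = id.
  by apply/funext => x; rewrite grng_unit.
by split=> [x|]; [exact: cvg_id|exists id; split=> // x; exact: cvg_id].
Defined.

Definition brng_inv b : gunits G -> gunits G :=
  projT1 (cid (proj2 (bfun_rng b))).

Lemma brng_inv_continuous b : continuous (brng_inv b).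
Proof. by rewrite /brng_inv; case: cid => h /= []. Qed.

Lemma brng_invK b x : grng (b (brng_inv b x)) = x.
Proof. by rewrite /brng_inv; case: cid => h /= []. Qed.

Lemma brngK b x : brng_inv b (grng (b x)) = x.
Proof. by rewrite /brng_inv; case: cid => h /= []. Qed.

Definition binv b : bisection G.
Proof.
refine (@Bisection G (fun x => ginv (b (brng_inv b x))) _ _ _).
- move=> x; apply: (@continuous_comp _ _ _ (fun x => b (brng_inv b x)) _ x);
    last exact: ginv_continuous.
  apply: (@continuous_comp _ _ _ (brng_inv b) b x).
    exact: brng_inv_continuous.
  exact: bfun_continuous.
- by move=> x; rewrite gsrc_inv brng_invK.
- have -> : (fun x => grng (ginv (b (brng_inv b x)))) = brng_inv b.
    by apply/funext => x; rewrite grng_inv bfun_src.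
  split; first exact: brng_inv_continuous.
  exists (fun x => grng (b x)); split=> [|x|x].
  + by have [] := bfun_rng b.
  + exact: brng_invK.
  + exact: brngK.
Defined.

Lemma bmulA : associative bmul.
Proof.
move=> b1 b2 b3; apply: bisection_eq => x /=.
by rewrite bmul_rngE gmulA ?bfun_src.
Qed.

Lemma bmul1b : left_id bone bmul.
Proof. by move=> b; apply: bisection_eq => x /=; rewrite gmul1g. Qed.

Lemma bmulb1 : right_id bone bmul.
Proof.
move=> b; apply: bisection_eq => x /=.
by rewrite grng_unit -[in X in gmul _ X](bfun_src b x) gmulg1.
Qed.

Lemma bmulVb : left_inverse bone binv bmul.
Proof.
by move=> b; apply: bisection_eq => x /=; rewrite brngK gmulVg bfun_src.
Qed.

Lemma bmulbV : right_inverse bone binv bmul.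
Proof.
move=> b; apply: bisection_eq => x /=.
by rewrite grng_inv bfun_src gmulgV brng_invK.
Qed.

End BisectionGroup.

HB.instance Definition _ (G : topGroupoid) := gen_eqMixin (bisection G).
HB.instance Definition _ (G : topGroupoid) := gen_choiceMixin (bisection G).
HB.instance Definition _ (G : topGroupoid) := isGroup.Build (bisection G)
  bmulA bmul1b bmulb1 bmulVb bmulbV.

Definition two_action (Gamma : groupType) (G : topGroupoid) :=
  {multiplicative Gamma -> bisection G}.

(* The symmetric group with product (s * t) i = s (t i); the group structure of
   the library on 'S_N has the opposite product. *)
Definition symgrp (N : nat) : Type := 'S_N.

HB.instance Definition _ (N : nat) := Choice.on (symgrp N).

Section SymGroup.
Context {N : nat}.

Definition sym_mul (s t : symgrp N) : symgrp N := (t * s :> 'S_N)%g.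

Lemma sym_mulA : associative sym_mul.
Proof. by move=> s t u; rewrite /sym_mul mulgA. Qed.

Lemma sym_mul1 : left_id (1%g : 'S_N) sym_mul.
Proof. by move=> s; rewrite /sym_mul mulg1. Qed.

Lemma sym_1mul : right_id (1%g : 'S_N) sym_mul.
Proof. by move=> s; rewrite /sym_mul mul1g. Qed.

Lemma sym_mulV : left_inverse (1%g : 'S_N) (@invg 'S_N) sym_mul.
Proof. by move=> s; rewrite /sym_mul mulgV. Qed.

Lemma sym_Vmul : right_inverse (1%g : 'S_N) (@invg 'S_N) sym_mul.
Proof. by move=> s; rewrite /sym_mul mulVg. Qed.

HB.instance Definition _ := isGroup.Build (symgrp N)
  sym_mulA sym_mul1 sym_1mul sym_mulV sym_Vmul.

End SymGroup.

Lemma cvg_set_type (X : topologicalType) (A : set X) (T : Type)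
    (F : set_system T) {FF : Filter F} (f : T -> A) (x : A) :
  (fun t => val (f t)) @ F --> val x -> f @ F --> x.
Proof.
move=> Fx W; rewrite nbhsE => -[V [[U oU <-] Ux] VW].
apply: (@filterS _ F _ (fun t => U (val (f t)))); first by move=> t /= /VW.
by apply: (Fx U); exact: open_nbhs_nbhs.
Qed.

Lemma continuous_val (X : topologicalType) (A : set X) :
  continuous (fun x : A => val x).
Proof. exact: (@initial_continuous _ _ (@set_val _ A)). Qed.

Lemma continuous_set_type (X Y : topologicalType) (A : set X) (f : Y -> A) :
  continuous (fun y => val (f y)) -> continuous f.
Proof. by move=> cf y; apply: (@cvg_set_type _ _ _ (nbhs y)); exact: cf. Qed.

Lemma cvg_pair2 (X Y : topologicalType) (T : Type) (F : set_system T)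
    {FF : Filter F} (f : T -> X) (g : T -> Y) (x : X) (y : Y) :
  f @ F --> x -> g @ F --> y -> (fun t => (f t, g t)) @ F --> (x, y).
Proof. by move=> Fx Fy; exact: cvg_pair. Qed.

Definition hatDel2 (R : realType) (d : nat) (r Rc : R) (n : nat) :
    set (hatDel d r Rc n * hatDel d r Rc n) :=
  [set p | lat p.1 = lat p.2].

Section GN.
Context {R : realType} {d : nat} {r Rc : R} (L0 : Del d r Rc) (n : nat).
Local Notation hatDel := (hatDel d r Rc n).

Definition XiN : set hatDel :=
  [set xi | hull L0 (lat xi) /\ lab xi ord0 = 0].

Definition GN_arrows : set (hatDel * hatDel) :=
  [set p | [/\ hatDel2 p, hull L0 (lat p.1) & lab p.1 ord0 = 0]].

Lemma GN_latE (g : GN_arrows) : lat (val g).1 = lat (val g).2.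
Proof. by have [] := set_mem (valP g). Qed.

Lemma GN_hull (g : GN_arrows) : hull L0 (lat (val g).1).
Proof. by have [] := set_mem (valP g). Qed.

Lemma GN_lab0 (g : GN_arrows) : lab (val g).1 ord0 = 0.
Proof. by have [] := set_mem (valP g). Qed.

Lemma GN_rng_subproof (g : GN_arrows) : XiN (val g).1.
Proof. by split; [exact: GN_hull|exact: GN_lab0]. Qed.

Definition GN_rng (g : GN_arrows) : XiN :=
  exist _ (val g).1 (mem_set (GN_rng_subproof g)).

Lemma GN_src_subproof (g : GN_arrows) :
  XiN (ttr (lab (val g).2 ord0) (val g).2).
Proof.
split=> /=; last by rewrite subrr.
by apply: hull_translate; rewrite -GN_latE; exact: GN_hull.
Qed.

Definition GN_src (g : GN_arrows) : XiN :=
  exist _ (ttr (lab (val g).2 ord0) (val g).2) (mem_set (GN_src_subproof g)).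

Lemma GN_unit_subproof (x : XiN) : GN_arrows (val x, val x).
Proof. by have [] := set_mem (valP x). Qed.

Definition GN_unit (x : XiN) : GN_arrows :=
  exist _ (val x, val x) (mem_set (GN_unit_subproof x)).

Lemma GN_inv_subproof (g : GN_arrows) :
  GN_arrows (ttr2 (lab (val g).2 ord0) ((val g).2, (val g).1)).
Proof.
split=> /=; last by rewrite subrr.
- by rewrite /hatDel2/= GN_latE.
- by apply: hull_translate; rewrite -GN_latE; exact: GN_hull.
Qed.

Definition GN_inv (g : GN_arrows) : GN_arrows :=
  exist _ (ttr2 (lab (val g).2 ord0) ((val g).2, (val g).1))
    (mem_set (GN_inv_subproof g)).

Lemma GN_mul_subproof (g h : GN_arrows) : GN_src g = GN_rng h ->
  GN_arrows ((val g).1, ttr (- lab (val g).2 ord0) (val h).2).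
Proof.
move=> /(congr1 val)/= gh; split=> /=; [|exact: GN_hull|exact: GN_lab0].
rewrite /hatDel2/= GN_latE; apply: Del_eq => /=.
by rewrite -(GN_latE h) -gh /= translateD subrr translate0.
Qed.

(* For g = (xi, zeta) and h = ttr2 (lab zeta ord0) (zeta, zeta'), the product
   is (xi, zeta'): see [GN_mulE]. *)
Definition GN_mul (g h : GN_arrows) : GN_arrows :=
  if pselect (GN_src g = GN_rng h) is left gh
  then exist _ ((val g).1, ttr (- lab (val g).2 ord0) (val h).2)
         (mem_set (GN_mul_subproof gh))
  else g.

Lemma GN_mul_val g h : GN_src g = GN_rng h ->
  val (GN_mul g h) = ((val g).1, ttr (- lab (val g).2 ord0) (val h).2).
Proof. by move=> gh; rewrite /GN_mul; case: pselect. Qed.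

Lemma GN_mulE g h (xi zeta zeta' : hatDel) :
  val g = (xi, zeta) -> val h = ttr2 (lab zeta ord0) (zeta, zeta') ->
  val (GN_mul g h) = (xi, zeta').
Proof.
move=> gE hE; rewrite GN_mul_val; last by apply: val_inj; rewrite /= gE hE.
by rewrite gE hE /= ttrD subrr ttr0.
Qed.

Lemma cvg_GN1 (g : GN_arrows) :
  (fun x : GN_arrows => (val x).1) @ g --> (val g).1.
Proof.
apply: (@cvg_comp _ _ _ (fun x : GN_arrows => val x) fst (nbhs g)
  (nbhs (val g))); first exact: continuous_val.
by case: (val g) => a b; exact: cvg_fst.
Qed.

Lemma cvg_GN2 (g : GN_arrows) :
  (fun x : GN_arrows => (val x).2) @ g --> (val g).2.
Proof.
apply: (@cvg_comp _ _ _ (fun x : GN_arrows => val x) snd (nbhs g)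
  (nbhs (val g))); first exact: continuous_val.
by case: (val g) => a b; exact: cvg_snd.
Qed.

Arguments cvg_GN1 : clear implicits.
Arguments cvg_GN2 : clear implicits.

Lemma GN_rng_continuous : continuous GN_rng.
Proof. by apply: continuous_set_type => g; exact: cvg_GN1. Qed.

Lemma GN_src_continuous : continuous GN_src.
Proof.
apply: continuous_set_type => g /=.
by apply: (@cvg_ttr _ _ _ _ _ _ (nbhs g) _ _ _ _ _ (cvg_GN2 g));
  exact: (@cvg_lab _ _ _ _ _ _ (nbhs g) _ _ _ _ (cvg_GN2 g)).
Qed.

Lemma GN_unit_continuous : continuous GN_unit.
Proof.
apply: continuous_set_type => x.
by apply: (@cvg_pair2 _ _ _ (nbhs x)); exact: continuous_val.
Qed.

Lemma GN_inv_continuous : continuous GN_inv.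
Proof.
apply: continuous_set_type => g; apply: (@cvg_pair2 _ _ _ (nbhs g)).
- by apply: (@cvg_ttr _ _ _ _ _ _ (nbhs g) _ _ _ _ _ (cvg_GN2 g));
  exact: (@cvg_lab _ _ _ _ _ _ (nbhs g) _ _ _ _ (cvg_GN2 g)).
- by apply: (@cvg_ttr _ _ _ _ _ _ (nbhs g) _ _ _ _ _ (cvg_GN1 g));
  exact: (@cvg_lab _ _ _ _ _ _ (nbhs g) _ _ _ _ (cvg_GN2 g)).
Qed.

Lemma GN_mul_continuous :
  {within [set p : GN_arrows * GN_arrows | GN_src p.1 = GN_rng p.2],
    continuous (fun p => GN_mul p.1 p.2)}.
Proof.
apply/subspace_continuousP => -[g h] /= gh.
set A := [set p | _]; set F := within _ _.
have FF : Filter F by exact: within_filter.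
have FA : F A by exact: withinT.
apply: (@cvg_set_type _ _ _ F); rewrite GN_mul_val//.
have F1 : (fun p : GN_arrows * GN_arrows => p.1) @ F --> g.
  exact: cvg_comp (@cvg_within _ _ _ _) cvg_fst.
have F2 : (fun p : GN_arrows * GN_arrows => p.2) @ F --> h.
  exact: cvg_comp (@cvg_within _ _ _ _) cvg_snd.
apply: cvg_trans (_ : (fun p : GN_arrows * GN_arrows =>
    ((val p.1).1, ttr (- lab (val p.1).2 ord0) (val p.2).2)) @ F --> _).
  apply: (@near_eq_cvg _ _ F); apply: filterS FA => p /= pA.
  by rewrite GN_mul_val.
have c2 : (fun p : GN_arrows * GN_arrows => (val p.1).2) @ F --> (val g).2.
  exact: cvg_comp F1 (cvg_GN2 g).
apply: cvg_pair2.
  exact: cvg_comp F1 (cvg_GN1 g).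
apply: cvg_ttr; first exact: cvg_comp F2 (cvg_GN2 h).
move=> e e0; apply: filterS (cvg_lab ord0 c2 e0) => p.
by rewrite -opprD enormN.
Qed.

Lemma GN_src_unit x : GN_src (GN_unit x) = x.
Proof.
by have [_ x0] := set_mem (valP x); apply: val_inj; rewrite /= x0 ttr0.
Qed.

Lemma GN_rng_unit x : GN_rng (GN_unit x) = x.
Proof. exact: val_inj. Qed.

Lemma GN_src_inv g : GN_src (GN_inv g) = GN_rng g.
Proof.
apply: val_inj => /=; rewrite ttrD GN_lab0 sub0r subrr; exact: ttr0.
Qed.

Lemma GN_rng_inv g : GN_rng (GN_inv g) = GN_src g.
Proof. exact: val_inj. Qed.

Lemma GN_src_mul g h : GN_src g = GN_rng h -> GN_src (GN_mul g h) = GN_src h.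
Proof.
move=> gh; apply: val_inj; rewrite /= GN_mul_val//= opprK ttrD.
by congr (ttr _ _); rewrite addrCA addNr addr0.
Qed.

Lemma GN_rng_mul g h : GN_src g = GN_rng h -> GN_rng (GN_mul g h) = GN_rng g.
Proof. by move=> gh; apply: val_inj; rewrite /= GN_mul_val. Qed.

Lemma GN_mulA g h k : GN_src g = GN_rng h -> GN_src h = GN_rng k ->
  GN_mul g (GN_mul h k) = GN_mul (GN_mul g h) k.
Proof.
move=> gh hk; apply: val_inj.
rewrite !GN_mul_val ?GN_src_mul ?GN_rng_mul//= ttrD.
by rewrite opprB addrC.
Qed.

Lemma GN_mul1g g : GN_mul (GN_unit (GN_rng g)) g = g.
Proof.
apply: val_inj; rewrite GN_mul_val ?GN_src_unit//= GN_lab0 oppr0 ttr0.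
by rewrite -surjective_pairing.
Qed.

Lemma GN_mulg1 g : GN_mul g (GN_unit (GN_src g)) = g.
Proof.
apply: val_inj; rewrite GN_mul_val ?GN_rng_unit//= ttrD subrr ttr0.
by rewrite -surjective_pairing.
Qed.

Lemma GN_mulVg g : GN_mul (GN_inv g) g = GN_unit (GN_src g).
Proof.
apply: val_inj; rewrite GN_mul_val ?GN_src_inv//=.
by rewrite GN_lab0 sub0r opprK.
Qed.

Lemma GN_mulgV g : GN_mul g (GN_inv g) = GN_unit (GN_rng g).
Proof.
by apply: val_inj; rewrite GN_mul_val ?GN_rng_inv//= ttrD subrr ttr0.
Qed.

(* A unit (xi, xi) is identified with xi in XiN. *)
Definition GN : topGroupoid := TopGroupoid
  GN_src_unit GN_rng_unit GN_src_inv GN_rng_inv GN_src_mul GN_rng_mul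
  GN_mulA GN_mul1g GN_mulg1 GN_mulVg GN_mulgV
  GN_src_continuous GN_rng_continuous GN_unit_continuous
  GN_inv_continuous GN_mul_continuous.

End GN.

Arguments XiN {R d r Rc} L0 n _.
Arguments GN_arrows {R d r Rc} L0 n _.
Arguments GN {R d r Rc} L0 n.

(* Main.v *)
Require Import Defs.
From HB Require Import structures.
From mathcomp Require Import all_boot all_order all_algebra all_fingroup.
From mathcomp Require Import all_classical all_reals all_analysis.

Set Implicit Arguments.
Unset Strict Implicit.
Unset Printing Implicit Defensive.
Import Order.TTheory GRing.Theory Num.Theory.
Local Open Scope classical_set_scope.
Local Open Scope ring_scope.

(** Write [rebase s xi] for the first component of [tau s xi]: relabel [xi] by
[s], then translate so that the new first vertex is again the origin. Two facts
carry the proof.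

Relabelling commutes with translation, and only the last translation to the
origin matters. Hence [rebase] is a left action of the symmetric group on the
unit space ([rebaseXiM], [rebaseXi1]). Both operations are continuous for the
topology of labelled Delone sets, so each [rebaseXi s] is a homeomorphism, with
inverse [rebaseXi s^-1].

The arrow [tau s xi] has range [rebase s xi]. Its source is [xi]: both
components are translated by the same vector, so moving the first vertex of the
second one back to the origin undoes that translation. Thus [tau s] is a
continuous section of the source map whose composite with the range map is a
homeomorphism, that is, a bisection. In the product of [tau s] at
[rebase t xi] with [tau t] at [xi], the first component is
[rebase s (rebase t xi)], which is [rebase (s * t) xi], and the second is [xi]
moved by the sum of the two translation vectors. The second vector is the
position of a vertex of [xi] after the first translation, so the sum telescopes
to the original position of that vertex, which is the vector of
[tau (s * t) xi] ([permarrowM]). *)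

Section Relabelling.
Context {R : realType} {d : nat} {r Rc : R} {n : nat}.
Local Notation hatDel := (hatDel d r Rc n).
Implicit Types (s t : symgrp n.+1) (xi : hatDel).

Lemma Lambda_ttr s x xi : Lambda s (ttr x xi) = ttr x (Lambda s xi).
Proof. exact: hatDel_eq. Qed.

Lemma Lambda1 xi : Lambda (1%g : symgrp n.+1) xi = xi.
Proof. by apply: hatDel_eq => // i /=; rewrite invg1 perm1. Qed.

(** The group [symgrp] is [perm] with the opposite product, so its inverse and
unit are those of [perm] only up to unfolding; [symgrpV1] and [symgrpVM] are
stated pointwise to keep this conversion out of later proofs. *)
Lemma symgrpV1 (i : 'I_n.+1) : ((1 : symgrp n.+1)^-1)%g i = i.
Proof. by rewrite [LHS](_ : _ = (1 : 'S_n.+1)^-1%g i)// invg1 perm1. Qed.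

Lemma symgrpVM s t i : ((s * t)^-1)%g i = (t^-1)%g ((s^-1)%g i).
Proof. by rewrite [LHS](_ : _ = ((t : 'S_n.+1) * s)^-1%g i)// invMg permM. Qed.

Lemma LambdaM s t xi : Lambda (s * t)%g xi = Lambda s (Lambda t xi).
Proof. by apply: hatDel_eq => // i /=; rewrite -symgrpVM. Qed.

(** Basic neighbourhoods bound the displacement of all labels uniformly, and
relabelling only permutes these bounds. *)
Lemma cvg_Lambda s (T : Type) (F : set_system T) {FF : Filter F}
    (f : T -> hatDel) xi :
  f @ F --> xi -> (fun u => Lambda s (f u)) @ F --> Lambda s xi.
Proof.
move=> /cvg_hatDelP Fxi; apply/cvg_hatDelP => e M e0.
apply: filterS (Fxi e M e0) => u /(basic_nbhsP _ _ _ e0)[dL dl].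
by apply/basic_nbhsP => //; split=> // i; exact: dl.
Qed.

Definition rebase s xi : hatDel := ttr (lab xi ((s^-1)%g ord0)) (Lambda s xi).

Lemma rebase1 xi : lab xi ord0 = 0 -> rebase 1%g xi = xi.
Proof. by move=> xi0; rewrite /rebase symgrpV1 xi0 ttr0 Lambda1. Qed.

(** The translation vector of the outer [rebase] is measured after the inner
translation, so the two vectors add up to the position in [xi] of the vertex
that finally gets label [ord0]. *)
Lemma rebaseM s t xi : rebase (s * t)%g xi = rebase s (rebase t xi).
Proof.
rewrite /rebase Lambda_ttr -LambdaM ttrD symgrpVM.
by congr (ttr _ _); rewrite addrC subrK.
Qed.

Lemma cvg_rebase s (T : Type) (F : set_system T) {FF : Filter F}
    (f : T -> hatDel) xi :
  f @ F --> xi -> (fun u => rebase s (f u)) @ F --> rebase s xi.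
Proof.
move=> Fxi; apply: cvg_ttr; first exact: cvg_Lambda.
exact: cvg_lab.
Qed.

End Relabelling.

Section PermutationBisection.
Context {R : realType} {d : nat} {r Rc : R} (L0 : Del d r Rc) (n : nat).
Implicit Types (s t : symgrp n.+1) (x : XiN L0 n).

Lemma XiN_lab0 x : lab (val x) ord0 = 0.
Proof. by have [] := set_mem (valP x). Qed.

Lemma rebase_XiN s x : XiN L0 n (rebase s (val x)).
Proof.
have [hx _] := set_mem (valP x).
by split; [exact: hull_translate|rewrite /= subrr].
Qed.

Definition rebaseXi s x : XiN L0 n :=
  exist _ (rebase s (val x)) (mem_set (rebase_XiN s x)).

Lemma rebaseXi1 : rebaseXi 1%g =1 id.
Proof. by move=> x; apply: val_inj; exact: rebase1 (XiN_lab0 x). Qed.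

Lemma rebaseXiM s t x :
  rebaseXi (s * t)%g x = rebaseXi s (rebaseXi t x).
Proof. by apply: val_inj; exact: rebaseM. Qed.

Lemma rebaseXi_continuous s : continuous (rebaseXi s).
Proof.
apply: continuous_set_type => x.
by apply: (@cvg_rebase _ _ _ _ _ _ _ (nbhs x)); exact: continuous_val.
Qed.

Lemma rebaseXi_homeomorphism s : homeomorphism (rebaseXi s).
Proof.
split; first exact: rebaseXi_continuous.
exists (rebaseXi s^-1%g); split; first exact: rebaseXi_continuous.
- by move=> x; rewrite -rebaseXiM mulVg rebaseXi1.
- by move=> x; rewrite -rebaseXiM mulgV rebaseXi1.
Qed.

Lemma permarrow_subproof s x :
  GN_arrows L0 n
    (ttr2 (lab (val x) ((s^-1)%g ord0)) (Lambda s (val x), val x)).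
Proof. by have [hx x0] := rebase_XiN s x. Qed.

Definition permarrow s x : GN_arrows L0 n :=
  exist _ (ttr2 (lab (val x) ((s^-1)%g ord0)) (Lambda s (val x), val x))
    (mem_set (permarrow_subproof s x)).

Lemma permarrow_src s x : GN_src (permarrow s x) = x.
Proof. by apply: val_inj; rewrite /= ttrD XiN_lab0 sub0r subrr ttr0. Qed.

Lemma permarrow_rng s x : GN_rng (permarrow s x) = rebaseXi s x.
Proof. exact: val_inj. Qed.

Lemma permarrow_rng_homeomorphism s :
  homeomorphism (fun x => GN_rng (permarrow s x)).
Proof.
rewrite (_ : (fun x => _) = rebaseXi s); first exact: rebaseXi_homeomorphism.
by apply/funext => x; rewrite permarrow_rng.
Qed.

Lemma permarrow_continuous s : continuous (permarrow s).
Proof.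
apply: continuous_set_type => x.
have cx : (fun y : XiN L0 n => val y) @ x --> val x by exact: continuous_val.
apply: (@cvg_pair2 _ _ _ (nbhs x)).
  exact: (@cvg_rebase _ _ _ _ _ _ _ (nbhs x)).
by apply: (@cvg_ttr _ _ _ _ _ _ (nbhs x)) => //;
  exact: (@cvg_lab _ _ _ _ _ _ (nbhs x)).
Qed.

Definition permbisection s : bisection (GN L0 n) :=
  @Bisection (GN L0 n) (permarrow s) (@permarrow_continuous s)
    (permarrow_src s) (permarrow_rng_homeomorphism s).

(** The groupoid product translates the second component of its right factor by
minus the base label of the second component of its left factor. That label is
minus the vector of [permarrow s], since units have base label 0. *)
Lemma permarrowM s t x :
  GN_mul (permarrow s (rebaseXi t x)) (permarrow t x) = permarrow (s * t)%g x.
Proof.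
apply: val_inj; rewrite GN_mul_val ?permarrow_src ?permarrow_rng//=.
congr (_, _); first by rewrite -[LHS]/(rebase s (rebase t (val x))) -rebaseM.
by rewrite subrr sub0r opprK ttrD symgrpVM addrC subrK.
Qed.

Lemma permbisectionM : {morph permbisection : s t / (s * t)%g >-> (s * t)%g}.
Proof.
move=> s t; apply: bisection_eq => x /=.
by rewrite -permarrowM permarrow_rng.
Qed.

HB.instance Definition _ := isMultiplicative.Build (symgrp n.+1)
  (bisection (GN L0 n)) permbisection permbisectionM.

End PermutationBisection.

Theorem proposition6p42 (R : realType) (d : nat) (r Rc : R)
    (hd : (0 < d)%N) (hr : 0 < r) (hRc : r < Rc)
    (L0 : Del d r Rc) (n : nat) :
  exists tau : two_action (symgrp n.+1) (GN L0 n),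
    forall (s : symgrp n.+1) (xi : XiN L0 n),
      val (tau s xi) =
        ttr2 (lab (val xi) ((s^-1)%g ord0)) (Lambda s (val xi), val xi).
Proof. by exists (permbisection L0 (n := n)). Qed.
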